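(* Let $\Gamma=(V,H)$ be an oriented hypergraph with vertex set $V=\{1,\ldots,n\}$ and hyperedge set $H=\{h_1,\ldots,h_m\}$, in which no vertex has degree zero, and let $p\in\mathbb{R}_{>1}$. Then a function $f\in C(V)\setminus\{0\}$ is an eigenfunction of the vertex $p$-Laplacian $\Delta_p$ with corresponding eigenvalue $\lambda$ (i.e. $\Delta_p f=\lambda|f|^{p-2}f$) if and only if $\nabla \mathrm{RQ}_p(f)=0$ and $\lambda=\mathrm{RQ}_p(f)$. Similarly, $\gamma\in C(H)\setminus\{0\}$ is an eigenfunction of the hyperedge $p$-Laplacian $\Delta_p^H$ with corresponding eigenvalue $\mu$ (i.e. $\Delta^H_p\gamma=\mu|\gamma|^{p-2}\gamma$) if and only if $\nabla\mathrm{RQ}_p(\gamma)=0$ and $\mu=\mathrm{RQ}_p(\gamma)$.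
   Context: An oriented hypergraph $\Gamma=(V,H)$ consists of a finite vertex set $V$ and a finite set $H$ of hyperedges, each hyperedge $h$ being a pair $(h_{in},h_{out})$ of disjoint subsets of $V$ (inputs and outputs) with nonempty union; we also write $h$ for the set $h_{in}\cup h_{out}$. The degree $\deg(i)$ of a vertex $i$ is the number of hyperedges $h$ with $i\in h$; it is assumed $\deg(i)\ge 1$ for all $i$. $C(V)\cong\mathbb{R}^n$ denotes the functions $V\to\mathbb{R}$ and $C(H)\cong\mathbb{R}^m$ the functions $H\to\mathbb{R}$. For $h\in H$ and $i\in V$ let $\mathcal{I}^h(i)=\mathcal{I}_i(h)$ be $1$ if $i\in h_{in}$, $-1$ if $i\in h_{out}$, and $0$ otherwise; write $\langle \mathcal{I}^h,f\rangle=\sum_{i\in h_{in}}f(i)-\sum_{j\in h_{out}}f(j)$ and $\langle\mathcal{I}_i,\gamma\rangle=\sum_{h:\,i\in h_{in}}\gamma(h)-\sum_{h:\,i\in h_{out}}\gamma(h)$. Throughout, $|x|^{p-2}x$ is interpreted as $0$ when $x=0$. For $p>1$ the vertex $p$-Laplacian is $\Delta_pf(i)=\frac{1}{\deg(i)}\sum_{h\ni i}\mathcal{I}^h(i)\,|\langle\mathcal{I}^h,f\rangle|^{p-2}\langle\mathcal{I}^h,f\rangle$, and the hyperedge $p$-Laplacian is $\Delta^H_p\gamma(h)=\sum_{i\in h}\frac{1}{\deg(i)}\mathcal{I}_i(h)\,|\langle\mathcal{I}_i,\gamma\rangle|^{p-2}\langle\mathcal{I}_i,\gamma\rangle$. The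 generalized Rayleigh quotients are $\mathrm{RQ}_p(f)=\frac{\sum_{h\in H}|\langle\mathcal{I}^h,f\rangle|^p}{\sum_{i\in V}\deg(i)|f(i)|^p}$ for $f\in C(V)\setminus\{0\}$ and $\mathrm{RQ}_p(\gamma)=\frac{\sum_{i\in V}\frac{1}{\deg(i)}|\langle\mathcal{I}_i,\gamma\rangle|^p}{\sum_{h\in H}|\gamma(h)|^p}$ for $\gamma\in C(H)\setminus\{0\}$; $\nabla$ denotes the ordinary gradient. *)

(* Defs.v *)
From HB Require Import structures.
From mathcomp Require Import all_boot all_order all_algebra.
From mathcomp Require Import all_classical all_reals all_analysis.

Set Implicit Arguments.
Unset Strict Implicit.
Unset Printing Implicit Defensive.
Import Order.TTheory GRing.Theory Num.Theory.
Import numFieldNormedType.Exports.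
Local Open Scope ring_scope.

(* Vertices are 'I_n and hyperedges h_1, ..., h_m are indexed by 'I_m;
   [hedge h] is the pair (inputs, outputs). Since the hyperedges form a set of
   such pairs, the enumeration is injective. *)
Record oriented_hypergraph (n m : nat) := OrientedHypergraph {
  hedge : 'I_m -> {set 'I_n} * {set 'I_n};
  hedge_inj : injective hedge;
  hedge_disjoint : forall h, [disjoint (hedge h).1 & (hedge h).2];
  hedge_neq0 : forall h, (hedge h).1 :|: (hedge h).2 != finset.set0 }.

Section Hypergraph.
Context {n m : nat} (G : oriented_hypergraph n m).

Definition hin (h : 'I_m) : {set 'I_n} := (hedge G h).1.
Definition hout (h : 'I_m) : {set 'I_n} := (hedge G h).2.
Definition hverts (h : 'I_m) : {set 'I_n} := hin h :|: hout h.

Definition hdeg (i : 'I_n) : nat := #|[set h : 'I_m | i \in hverts h]|.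

Context {R : realType}.

Definition incidence (h : 'I_m) (i : 'I_n) : R :=
  if i \in hin h then 1 else if i \in hout h then -1 else 0.

(* <I^h, f> *)
Definition hpair (h : 'I_m) (f : 'rV[R]_n) : R :=
  \sum_(i in hin h) f 0 i - \sum_(j in hout h) f 0 j.

(* <I_i, gamma> *)
Definition vpair (i : 'I_n) (g : 'rV[R]_m) : R :=
  \sum_(h | i \in hin h) g 0 h - \sum_(h | i \in hout h) g 0 h.

(* |x|^(p-2) x; the factor x makes this 0 at x = 0, whatever the value of the
   power there. *)
Definition signed_pow (p x : R) : R := `|x| `^ (p - 2) * x.

Definition vertex_Laplacian (p : R) (f : 'rV[R]_n) : 'rV[R]_n :=
  \row_i ((hdeg i)%:R^-1 *
    \sum_(h | i \in hverts h) incidence h i * signed_pow p (hpair h f)).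

Definition hyperedge_Laplacian (p : R) (g : 'rV[R]_m) : 'rV[R]_m :=
  \row_h \sum_(i in hverts h)
    (hdeg i)%:R^-1 * incidence h i * signed_pow p (vpair i g).

Definition vertex_RQ (p : R) (f : 'rV[R]_n) : R :=
  (\sum_h `|hpair h f| `^ p) / (\sum_i (hdeg i)%:R * `|f 0 i| `^ p).

Definition hyperedge_RQ (p : R) (g : 'rV[R]_m) : R :=
  (\sum_i (hdeg i)%:R^-1 * `|vpair i g| `^ p) / (\sum_h `|g 0 h| `^ p).

End Hypergraph.

Definition is_eigenfunction {R : realType} {k : nat} (p : R)
    (L : 'rV[R]_k -> 'rV[R]_k) (u : 'rV[R]_k) (a : R) : Prop :=
  u != 0 /\ L u = a *: map_mx (signed_pow p) u.

Definition gradient {R : realType} {k : nat} (F : 'rV[R]_k -> R)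
    (u : 'rV[R]_k) : 'rV[R]_k :=
  \row_i 'D_(delta_mx 0 i) F u.

(* [gradient] is total: where a partial derivative does not exist it takes an
   arbitrary value. Hence "the gradient of F at u is g" includes the
   differentiability of F at u. *)
Definition has_gradient {R : realType} {k : nat} (F : 'rV[R]_k -> R)
    (u g : 'rV[R]_k) : Prop :=
  differentiable F u /\ gradient F u = g.

(* Main.v *)
From HB Require Import structures.
Require Import Defs.
From mathcomp Require Import all_boot all_order all_algebra.
From mathcomp Require Import all_classical all_reals all_analysis.
From mathcomp Require Import ring.
(* Both quotients have the form N / D with N u = sum_j a_j |<c_j, u>|^p and
   D u = sum_i b_i |u_i|^p with b_i > 0, and since p > 1 the function |x|^p is
   differentiable everywhere, with derivative p |x|^(p-2) x. Hence the gradient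
   of N / D at u != 0 is (p / D u) (g u - (N / D) u * d u), where g u and d u are
   the gradients of N and D divided by p, and the eigenvalue equation reads
   g u = lambda * d u. Pairing this equation with u gives N u = lambda * D u,
   so lambda is forced to be the value of the quotient. *)

Set Implicit Arguments.
Unset Strict Implicit.
Unset Printing Implicit Defensive.
Import Order.TTheory GRing.Theory Num.Theory.
Import numFieldNormedType.Exports.
Local Open Scope ring_scope.
Local Open Scope classical_set_scope.

Lemma is_diff_sum (R : numFieldType) (V W : normedModType R) r
    (F dF : 'I_r -> V -> W) (x : V) :
  (forall i, is_diff x (F i) (dF i)) ->
  is_diff x (fun y => \sum_i F i y) (fun y => \sum_i dF i y).
Proof.
(* Once pointwise sums are read as sums of functions, [is_diff x] is a relation that contains the
   pair of zero functions and is stable under addition, as [big_ind2] requires. *)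
move=> dFi; rewrite -!fct_sumE.
by elim/big_ind2 : _ => // [|] *; [exact: is_diff_cst|exact: is_diffD].
Qed.

Lemma is_diff_coord (R : numFieldType) (r s : nat) (M : 'M[R]_(r, s)) i j :
  is_diff M (fun N : 'M[R]_(r, s) => N i j : R) (fun N => N i j).
Proof.
pose f (N : 'M[R]_(r, s)) : R := N i j.
have f_lin : linear f by move=> t A B; rewrite /f !mxE.
(* A continuous linear map is its own differential; the bundled form [fL] makes [diff_lin]
   applicable. *)
pose fL : {linear 'M[R]_(r, s) -> R} :=
  HB.pack f (GRing.isLinear.Build _ _ _ _ _ f_lin).
apply: DiffDef; first exact: differentiable_coord.
exact: (@diff_lin _ _ _ fL _ (@coord_continuous _ _ _ _ _)).
Qed.

Section SignedPower.
Context {R : realType}.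
Implicit Types p x : R.

Lemma signed_pow0 p : signed_pow p 0 = 0.
Proof. by rewrite /signed_pow mulr0. Qed.

Lemma mulr_signed_pow p x : 1 < p -> x * signed_pow p x = `|x| `^ p.
Proof.
move=> p1; rewrite /signed_pow; have [->|x0] := eqVneq x 0.
  (* Since [powR] gives 0 to the power 0 the value 1, the case x = 0 relies on p being nonzero. *)
  by rewrite mul0r normr0 powR0 // gt_eqF // (lt_trans ltr01).
rewrite mulrCA -expr2 -real_normK ?num_real // -powR_mulrn ?normr_ge0 //.
by rewrite -powRD ?normr_eq0 ?x0 ?implybT // subrK.
Qed.

Lemma is_derive_abs_powR_gt0 p x : 0 < x ->
  is_derive x 1 (fun y : R => `|y| `^ p) (p * signed_pow p x).
Proof.
move=> x0; apply: (@near_eq_is_derive _ _ _ (fun y : R => y `^ p)).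
  by near=> y; rewrite gtr0_norm //; near: y; exact: lt_nbhsr.
have -> : signed_pow p x = x `^ (p - 1).
  rewrite /signed_pow gtr0_norm // -{2}[x]powRr1 ?ltW //.
  rewrite -powRD ?(gt_eqF x0) ?implybT //.
  by have -> : p - 2 + 1 = p - 1 by ring.
exact: is_derive1_powR.
Unshelve. all: by end_near. Qed.

(** The difference quotient at 0 has absolute value |h|^(p-1), whose exponent is positive. *)
Lemma is_derive_abs_powR_at0 p : 1 < p ->
  is_derive (0 : R) 1 (fun y : R => `|y| `^ p) 0.
Proof.
move=> p1; have p0 : p != 0 by rewrite gt_eqF // (lt_trans ltr01).
have q0 : 0 < p - 1 by rewrite subr_gt0.
suff cv0 : h^-1 *: (((fun y : R => `|y| `^ p) \o shift 0) (h *: (1 : R))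
                     - `|(0 : R)| `^ p) @[h --> 0^'] --> (0 : R).
  by apply: DeriveDef; [apply/cvg_ex; exists 0|exact/cvg_lim].
apply/cvgr0Pnorm_lt => e e0; near=> h.
have h0 : h != 0 by near: h; exact: nbhs_dnbhs_neq.
rewrite /= normr0 powR0 // subr0 addr0 [h *: 1]mulr1 normrM normfV.
rewrite [`| _ `^ _|]ger0_norm ?powR_ge0 // mulrC.
rewrite -{2}[`|h|]powRr1 // -powRB ?normr_eq0 ?h0 ?implybT //.
(* The bound |h|^(p-1) < e amounts to |h| < e^(1/(p-1)), a positive radius. *)
have -> : e = (e `^ (p - 1)^-1) `^ (p - 1).
  by rewrite -powRrM mulVf ?gt_eqF // powRr1 // ltW.
rewrite gt0_ltr_powR // ?nnegrE ?powR_ge0 //.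
by near: h; apply: dnbhs0_lt; exact: powR_gt0.
Unshelve. all: by end_near. Qed.

Lemma is_derive_abs_powR p x : 1 < p ->
  is_derive x 1 (fun y : R => `|y| `^ p) (p * signed_pow p x).
Proof.
move=> p1; have [x0|x0|->] := ltgtP x 0.
(* For x < 0, evenness of |y|^p and the chain rule reduce the claim to the point -x > 0. *)
- have -> : (fun y : R => `|y| `^ p) = (fun y : R => `|y| `^ p) \o -%R.
    by apply/funext => y /=; rewrite normrN.
  have -> : p * signed_pow p x = p * signed_pow p (- x) * -1.
    by rewrite /signed_pow normrN; ring.
  apply: is_derive1_comp; apply: is_derive_abs_powR_gt0.
  by rewrite oppr_gt0.
- exact: is_derive_abs_powR_gt0.
- by rewrite signed_pow0 mulr0; exact: is_derive_abs_powR_at0.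
Qed.

Lemma is_diff_abs_powR p x : 1 < p ->
  is_diff x (fun y : R => `|y| `^ p) (fun h => h * (p * signed_pow p x)).
Proof.
move=> p1; have [dx dxE] := is_derive_abs_powR x p1.
apply: DiffDef; first exact/derivable1_diffP.
by rewrite diff1E; [rewrite derive1E dxE|exact/derivable1_diffP].
Qed.

End SignedPower.

Section RayleighQuotient.
Context {R : realType} {k q : nat}.
Variables (p : R) (c : 'I_q -> 'I_k -> R) (a : 'I_q -> R) (b : 'I_k -> R).
Implicit Types u v : 'rV[R]_k.

Definition dotrow (w : 'I_k -> R) u : R := \sum_i w i * u 0 i.

Lemma is_diff_dotrow w u : is_diff u (dotrow w) (dotrow w).
Proof. by apply: is_diff_sum => i; exact: (is_diffZ (w i) (is_diff_coord u 0 i)). Qed.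

(** For the vertex quotient, [c] is the incidence matrix, [a] is 1 and [b] is the degree; for the
    hyperedge quotient, [c] is its transpose, [a] is the inverse degree and [b] is 1. *)
Definition rayleigh_num u := \sum_j a j * `|dotrow (c j) u| `^ p.
Definition rayleigh_den u := \sum_i b i * `|u 0 i| `^ p.

Hypothesis p1 : 1 < p.

Lemma is_diff_rayleigh_num u : is_diff u rayleigh_num
  (fun v => \sum_j a j * (dotrow (c j) v * (p * signed_pow p (dotrow (c j) u)))).
Proof.
apply: is_diff_sum => j.
exact: (is_diffZ (a j) (is_diff_comp (is_diff_dotrow _ _) (is_diff_abs_powR _ p1))).
Qed.

Lemma is_diff_rayleigh_den u : is_diff u rayleigh_den
  (fun v => \sum_i b i * (v 0 i * (p * signed_pow p (u 0 i)))).
Proof.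
apply: is_diff_sum => i.
exact: (is_diffZ (b i) (is_diff_comp (is_diff_coord _ _ _) (is_diff_abs_powR _ p1))).
Qed.


Hypothesis b0 : forall i, 0 < b i.

Lemma rayleigh_den_gt0 u : u != 0 -> 0 < rayleigh_den u.
Proof.
move=> u0; have [i ui0] : exists i, u 0 i != 0.
  apply/existsP; apply: contra_neqT u0 => /existsPn u0.
  by apply/rowP => i; rewrite mxE; apply/eqP; have := u0 i; rewrite negbK.
rewrite /rayleigh_den (bigD1 i) //= ltr_pwDl //.
  by rewrite mulr_gt0 // powR_gt0 // normr_gt0.
by apply: sumr_ge0 => j _; rewrite mulr_ge0 ?powR_ge0 // ltW.
Qed.

Definition rayleigh u := rayleigh_num u / rayleigh_den u.

(* [rayleigh_num_grad u] is 1/p times the gradient of [rayleigh_num] at [u]. *)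
Definition rayleigh_num_grad u i := \sum_j a j * c j i * signed_pow p (dotrow (c j) u).

Lemma is_diff_rayleigh u : u != 0 -> is_diff u rayleigh
  (fun v => p / rayleigh_den u *
     (\sum_i v 0 i * (rayleigh_num_grad u i - rayleigh u * (b i * signed_pow p (u 0 i))))).
Proof.
move=> /rayleigh_den_gt0 D0; have D0' : rayleigh_den u != 0 by rewrite gt_eqF.
have dN := is_diff_rayleigh_num u; have dD := is_diff_rayleigh_den u.
have dV : is_diff u (fun y => (rayleigh_den y)^-1)
    (fun v => - (rayleigh_den u) ^- 2 *
              \sum_i b i * (v 0 i * (p * signed_pow p (u 0 i)))).
  by apply: DiffDef; [exact: differentiableV|rewrite diffV // diff_val].
apply: (is_diff_eq (is_diffM dN dV)); apply/funext => v.
(* [p * S1] and [p * S2] are the differentials of numerator and denominator in the direction [v];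
   the quotient rule then leaves a field identity. *)
pose S1 := \sum_i v 0 i * rayleigh_num_grad u i.
pose S2 := \sum_i v 0 i * (b i * signed_pow p (u 0 i)).
have -> : \sum_i v 0 i * (rayleigh_num_grad u i - rayleigh u * (b i * signed_pow p (u 0 i)))
    = S1 - rayleigh u * S2.
  by rewrite /S1 /S2 mulr_sumr -sumrB; apply: eq_bigr => i _; ring.
have E2 : \sum_i b i * (v 0 i * (p * signed_pow p (u 0 i))) = p * S2.
  by rewrite /S2 mulr_sumr; apply: eq_bigr => i _; ring.
have E1 : \sum_j a j * (dotrow (c j) v * (p * signed_pow p (dotrow (c j) u))) = p * S1.
  rewrite /S1 mulr_sumr.
  under [RHS]eq_bigr => i _ do rewrite mulrA /rayleigh_num_grad mulr_sumr.
  rewrite exchange_big; apply: eq_bigr => j _ /=.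
  by rewrite /dotrow mulr_suml mulr_sumr; apply: eq_bigr => i _; ring.
rewrite -[LHS]/(rayleigh_num u * (- rayleigh_den u ^- 2 *
    \sum_i b i * (v 0 i * (p * signed_pow p (u 0 i)))) + (rayleigh_den u)^-1 *
    \sum_j a j * (dotrow (c j) v * (p * signed_pow p (dotrow (c j) u)))) E1 E2 /rayleigh.
by field.
Qed.

(** Euler's identity for a function homogeneous of degree p; the usual factor p is absent because
    [rayleigh_num_grad] is already divided by it. *)
Lemma euler_rayleigh_num u : \sum_i u 0 i * rayleigh_num_grad u i = rayleigh_num u.
Proof.
under eq_bigr => i _ do rewrite mulr_sumr.
rewrite exchange_big; apply: eq_bigr => j _ /=.
rewrite -mulr_signed_pow // {2}/dotrow mulr_suml mulr_sumr.
by apply: eq_bigr => i _; ring.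
Qed.

Lemma euler_rayleigh_den u : \sum_i u 0 i * (b i * signed_pow p (u 0 i)) = rayleigh_den u.
Proof.
by apply: eq_bigr => i _; rewrite -mulr_signed_pow // mulrCA.
Qed.

Lemma rayleigh_criticalP u lam : u != 0 ->
  (forall i, rayleigh_num_grad u i = lam * (b i * signed_pow p (u 0 i))) <->
  has_gradient rayleigh u 0 /\ lam = rayleigh u.
Proof.
move=> u0; have D0 := rayleigh_den_gt0 u0; have D0' : rayleigh_den u != 0 by rewrite gt_eqF.
have dF := is_diff_rayleigh u0.
(* In the direction of the i-th basis vector only the i-th term of the differential survives. *)
have gradE i : gradient rayleigh u 0 i =
    p / rayleigh_den u * (rayleigh_num_grad u i - rayleigh u * (b i * signed_pow p (u 0 i))).
  rewrite mxE deriveE // diff_val (bigD1 i) //= big1 ?addr0.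
    by rewrite mxE !eqxx mul1r.
  by move=> j ji; rewrite mxE eqxx (negPf ji) mul0r.
split=> [eig|[[_ grad0] ->] i].
  have lamE : lam = rayleigh u.
    apply: (mulIf D0'); rewrite /rayleigh divfK // -euler_rayleigh_num -euler_rayleigh_den mulr_sumr.
    by apply: eq_bigr => i _; rewrite eig; ring.
  split=> //; split=> //; apply/rowP => i.
  by rewrite gradE eig lamE subrr mulr0 mxE.
(* The prefactor p / D is nonzero, so a zero gradient forces each bracket to vanish. *)
have /eqP := gradE i; rewrite grad0 mxE eq_sym !mulf_eq0 invr_eq0 (negPf D0') orbF.
by rewrite gt_eqF ?(lt_trans ltr01) //= subr_eq0 => /eqP.
Qed.

End RayleighQuotient.

Section Incidence.
Context {R : realType} {n m : nat} (G : oriented_hypergraph n m).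

(** Disjointness of inputs and outputs rules out the one case, [i] in both, where the two sides
    would differ. *)
Lemma incidenceE h i :
  incidence G h i = (i \in hin G h)%:R - (i \in hout G h)%:R :> R.
Proof.
rewrite /incidence; case: ifP => [ih|_]; last by case: ifP; rewrite ?subr0 ?sub0r.
by rewrite (disjointFr (hedge_disjoint G h) ih) subr0.
Qed.

(** This lets the sums over incident pairs in both Laplacians run over the whole index set. *)
Lemma incidence_notin h i : i \notin hverts G h -> incidence G h i = 0 :> R.
Proof.
by rewrite finset.in_setU negb_or incidenceE => /andP[/negPf-> /negPf->]; rewrite subr0.
Qed.

Lemma hpairE h (f : 'rV[R]_n) : hpair G h f = dotrow (incidence G h) f.
Proof.
rewrite /hpair /dotrow big_mkcond [X in _ - X]big_mkcond -sumrB.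
apply: eq_bigr => i _; rewrite incidenceE.
by case: (i \in hin G h); case: (i \in hout G h); rewrite /=; ring.
Qed.

Lemma vpairE i (g : 'rV[R]_m) : vpair G i g = dotrow ((incidence G)^~ i) g.
Proof.
rewrite /vpair /dotrow big_mkcond [X in _ - X]big_mkcond -sumrB.
apply: eq_bigr => h _; rewrite incidenceE.
by case: (i \in hin G h); case: (i \in hout G h); rewrite /=; ring.
Qed.

End Incidence.

Theorem theorem2p8 (R : realType) (n m : nat) (G : oriented_hypergraph n m)
    (hG : forall i : 'I_n, (1 <= hdeg G i)%N) (p : R) (hp : 1 < p) :
  (forall (f : 'rV[R]_n) (lambda : R), f != 0 ->
     (is_eigenfunction p (vertex_Laplacian G p) f lambda <->
      has_gradient (vertex_RQ G p) f 0 /\ lambda = vertex_RQ G p f)) /\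
  (forall (gamma : 'rV[R]_m) (mu : R), gamma != 0 ->
     (is_eigenfunction p (hyperedge_Laplacian G p) gamma mu <->
      has_gradient (hyperedge_RQ G p) gamma 0 /\ mu = hyperedge_RQ G p gamma)).
Proof.
have deg0 i : 0 < (hdeg G i)%:R :> R by rewrite ltr0n hG.
split=> [f|f] lam f0.
- have -> : vertex_RQ G p =
      rayleigh p (@incidence n m G R) (fun=> 1) (fun i => (hdeg G i)%:R).
    apply/funext => u; rewrite /vertex_RQ /rayleigh /rayleigh_num; congr (_ / _).
    by apply: eq_bigr => h _; rewrite hpairE mul1r.
  rewrite -rayleigh_criticalP //.
  (* The factor 1/deg of the Laplacian reappears as the weight deg in the denominator, so the two
     equations differ by a nonzero factor in each coordinate. *)
  have gradE i : rayleigh_num_grad p (@incidence n m G R) (fun=> 1) f i =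
      (hdeg G i)%:R * vertex_Laplacian G p f 0 i.
    rewrite mxE mulVKf ?gt_eqF // [RHS]big_mkcond; apply: eq_bigr => h _.
    rewrite mul1r -hpairE; case: ifPn => // ih.
    by rewrite incidence_notin // mul0r.
  split=> [[_ eig] i|eig].
    by rewrite gradE eig !mxE; ring.
  split=> //; apply/rowP => i; have d0 := gt_eqF (deg0 i).
  by apply: (mulfI (negbT d0)); rewrite -gradE eig !mxE; ring.
- have -> : hyperedge_RQ G p =
      rayleigh p (fun i h => @incidence n m G R h i) (fun i => (hdeg G i)%:R^-1) (fun=> 1).
    apply/funext => u; rewrite /hyperedge_RQ /rayleigh /rayleigh_num /rayleigh_den; congr (_ / _).
      by apply: eq_bigr => i _; rewrite vpairE.
    by apply: eq_bigr => h _; rewrite mul1r.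
  rewrite -rayleigh_criticalP //.
  (* Here 1/deg sits inside the sum as the weight [a], so the normalised gradient is the Laplacian
     itself. *)
  have gradE h : rayleigh_num_grad p (fun i h => @incidence n m G R h i)
      (fun i => (hdeg G i)%:R^-1) f h = hyperedge_Laplacian G p f 0 h.
    rewrite mxE [RHS]big_mkcond; apply: eq_bigr => i _.
    rewrite -vpairE; case: ifPn => // ih.
    by rewrite incidence_notin // mulr0 mul0r.
  split=> [[_ eig] h|eig].
    by rewrite gradE eig !mxE mul1r.
  by split=> //; apply/rowP => h; rewrite -gradE eig !mxE mul1r.
Qed.
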